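(* The four relations $\sqsupseteq_{1\text{-nv}}$, $\sqsupseteq_{2\text{-nv}}$, $\sqsupseteq_{1\text{-dly}}$ and $\sqsupseteq_{2\text{-dly}}$ on $\mathcal P$ coincide.
   Context: TACS. Fix a countable set $\Lambda$ of action names; $\overline{\Lambda}=\{\overline a : a\in\Lambda\}$ with $\overline{\overline a}=a$; $\mathcal A=\Lambda\cup\overline\Lambda\cup\{\tau\}$ is the set of actions (ranged over by $\alpha$), and $a$ ranges over $\Lambda\cup\overline\Lambda$. Terms (set $\widehat{\mathcal P}$) are generated by $P::=\mathbf 0\mid x\mid \alpha.P\mid \sigma.P\mid P+P\mid P|P\mid P\backslash L\mid P[f]\mid \mu x.P$, where $x$ ranges over a countably infinite set of variables, $L\subseteq\mathcal A\setminus\{\tau\}$ is finite, and $f:\mathcal A\to\mathcal A$ satisfies $f(\tau)=\tau$, $f(\overline a)=\overline{f(a)}$ and $f(\alpha)\neq\alpha$ for only finitely many $\alpha$. $\mu x$ binds $x$; $P[Q/x]$ denotes substitution of $Q$ for the free occurrences of $x$. A variable is guarded in a term if each of its occurrences is in the scope of an action prefix $\alpha.\_$ (a $\sigma$-prefix does not count). In every term $\mu x.P$, $x$ must be guarded in $P$. Processes (set $\mathcal P$) are the closed terms. $\overline L=\{\overline a: a\in L\}$. Urgent sets: $\mathcal U(\sigma.P)=\mathcal U(\mathbf 0)=\mathcal U(x)=\emptyset$, $\mathcal U(\alpha.P)=\{\alpha\}$, $\mathcal U(P+Q)=\mathcal U(P)\cup\mathcal U(Q)$, $\mathcal U(P|Q)=\mathcal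 U(P)\cup\mathcal U(Q)\cup\{\tau\mid \mathcal U(P)\cap\overline{\mathcal U(Q)}\neq\emptyset\}$, $\mathcal U(P\backslash L)=\mathcal U(P)\setminus(L\cup\overline L)$, $\mathcal U(P[f])=\{f(\alpha):\alpha\in\mathcal U(P)\}$, $\mathcal U(\mu x.P)=\mathcal U(P)$. Action transitions $\xrightarrow{\alpha}$ are the least relations with: $\alpha.P\xrightarrow{\alpha}P$; if $P\xrightarrow{\alpha}P'$ then $\sigma.P\xrightarrow{\alpha}P'$, $\mu x.P\xrightarrow{\alpha}P'[\mu x.P/x]$, $P+Q\xrightarrow{\alpha}P'$, $Q+P\xrightarrow{\alpha}P'$, $P|Q\xrightarrow{\alpha}P'|Q$, $Q|P\xrightarrow{\alpha}Q|P'$, $P[f]\xrightarrow{f(\alpha)}P'[f]$, and $P\backslash L\xrightarrow{\alpha}P'\backslash L$ if $\alpha\notin L\cup\overline L$; if $P\xrightarrow{a}P'$ and $Q\xrightarrow{\overline a}Q'$ then $P|Q\xrightarrow{\tau}P'|Q'$. Clock transitions $\xrightarrow{\sigma}_i$ ($i\in\{1,2\}$) are the least relations with: $\mathbf 0\xrightarrow{\sigma}_i\mathbf 0$; $a.P\xrightarrow{\sigma}_i a.P$ for $a\in\Lambda\cup\overline\Lambda$; $\sigma.P\xrightarrow{\sigma}_iP$; if $P\xrightarrow{\sigma}_iP'$ then $\mu x.P\xrightarrow{\sigma}_iP'[\mu x.P/x]$, $P\backslash L\xrightarrow{\sigma}_iP'\backslash L$, $P[f]\xrightarrow{\sigma}_iP'[f]$;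 if $P\xrightarrow{\sigma}_iP'$ and $Q\xrightarrow{\sigma}_iQ'$ then $P+Q\xrightarrow{\sigma}_iP'+Q'$, and $P|Q\xrightarrow{\sigma}_iP'|Q'$ provided $\tau\notin\mathcal U(P|Q)$; and, only for $i=2$: if $P\xrightarrow{\sigma}_2P'$ then $\sigma.P\xrightarrow{\sigma}_2P'$. $\xrightarrow{\sigma}_i^{*}$ and $\xrightarrow{\sigma}_i^{+}$ denote reflexive-transitive and transitive closure. For $i\in\{1,2\}$, $\mathcal R\subseteq\mathcal P\times\mathcal P$ is an i-naive faster-than relation if for all $(P,Q)\in\mathcal R$, $\alpha\in\mathcal A$: (1) $P\xrightarrow{\alpha}P'$ implies $\exists Q'$. $Q\xrightarrow{\alpha}Q'$, $(P',Q')\in\mathcal R$; (2) $Q\xrightarrow{\alpha}Q'$ implies $\exists P'$. $P\xrightarrow{\alpha}P'$, $(P',Q')\in\mathcal R$; (3) $P\xrightarrow{\sigma}_iP'$ implies $\exists Q'$. $Q\xrightarrow{\sigma}_iQ'$, $(P',Q')\in\mathcal R$. $\mathcal R$ is an i-delayed faster-than relation if for all $(P,Q)\in\mathcal R$, $\alpha\in\mathcal A$: (1) $P\xrightarrow{\alpha}P'$ implies $\exists Q'$. $Q\xrightarrow{\sigma}_i^{*}\xrightarrow{\alpha}\xrightarrow{\sigma}_i^{*}Q'$, $(P',Q')\in\mathcal R$; (2) $Q\xrightarrow{\alpha}Q'$ implies $\exists P'$. $P\xrightarrow{\alpha}P'$, $(P',Q')\in\mathcal R$; (3) $P\xrightarrow{\sigma}_iP'$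 implies $\exists Q'$. $Q\xrightarrow{\sigma}_i^{+}Q'$, $(P',Q')\in\mathcal R$. $P\sqsupseteq_{i\text{-nv}}Q$ (resp. $P\sqsupseteq_{i\text{-dly}}Q$) iff $(P,Q)$ lies in some i-naive (resp. i-delayed) faster-than relation. *)

(* Defs.v *)
From Stdlib Require Export Relation_Operators.
From mathcomp Require Export all_boot finmap.

Set Implicit Arguments.
Unset Strict Implicit.
Unset Printing Implicit Defensive.

Local Open Scope fset_scope.

(* [inl a] is the name a of Lambda and [inr a] is its complement. *)
Definition label (Lam : countType) : Type := (Lam + Lam)%type.

Definition co (Lam : countType) (a : label Lam) : label Lam :=
  match a with inl x => inr x | inr x => inl x end.

(* [None] is tau and [Some a] is the visible action a. *)
Definition act (Lam : countType) : Type := option (label Lam).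

Definition tau (Lam : countType) : act Lam := None.
Definition vis (Lam : countType) (a : label Lam) : act Lam := Some a.
Arguments tau {Lam}.

(* Complementation is defined on visible actions only, so the equation
   f(\bar a) = \bar{f(a)} presupposes that f(a) is visible. *)
Record relabeling (Lam : countType) := Relabeling {
  relab_fun :> act Lam -> act Lam;
  relab_tau : relab_fun tau = tau;
  relab_co : forall a : label Lam,
    exists2 b : label Lam,
      relab_fun (vis a) = vis b & relab_fun (vis (co a)) = vis (co b);
  relab_finite : exists S : {fset act Lam},
    forall alpha, relab_fun alpha != alpha -> alpha \in S }.

(* Terms up to alpha-conversion: variables are de Bruijn indices, and [Mu]
   binds index 0 of its body. *)
Inductive term (Lam : countType) : Type :=
| Nil
| Var of nat
| Pre of act Lam & term Lam
| Sig of term Lam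
| Sum of term Lam & term Lam
| Par of term Lam & term Lam
| Res of term Lam & {fset label Lam}
| Rel of term Lam & relabeling Lam
| Mu of term Lam.
Arguments Nil {Lam}.
Arguments Var {Lam}.

Fixpoint guarded (Lam : countType) (k : nat) (P : term Lam) : bool :=
  match P with
  | Nil => true
  | Var n => n != k
  | Pre _ _ => true
  | Sig P => guarded k P
  | Sum P Q => guarded k P && guarded k Q
  | Par P Q => guarded k P && guarded k Q
  | Res P _ => guarded k P
  | Rel P _ => guarded k P
  | Mu P => guarded k.+1 P
  end.

Fixpoint wf (Lam : countType) (P : term Lam) : bool :=
  match P with
  | Nil => true
  | Var _ => true
  | Pre _ P => wf P
  | Sig P => wf P
  | Sum P Q => wf P && wf Q
  | Par P Q => wf P && wf Q
  | Res P _ => wf P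
  | Rel P _ => wf P
  | Mu P => guarded 0 P && wf P
  end.

(* All free indices of P are below k. *)
Fixpoint closed_at (Lam : countType) (k : nat) (P : term Lam) : bool :=
  match P with
  | Nil => true
  | Var n => n < k
  | Pre _ P => closed_at k P
  | Sig P => closed_at k P
  | Sum P Q => closed_at k P && closed_at k Q
  | Par P Q => closed_at k P && closed_at k Q
  | Res P _ => closed_at k P
  | Rel P _ => closed_at k P
  | Mu P => closed_at k.+1 P
  end.

Definition is_process (Lam : countType) (P : term Lam) : bool :=
  wf P && closed_at 0 P.

Definition process (Lam : countType) : Type :=
  {P : term Lam | is_process P}.

(* Renames the free indices n >= c to n.+1. *)
Fixpoint lift_term (Lam : countType) (c : nat) (P : term Lam) : term Lam :=
  match P with
  | Nil => Nil
  | Var n => Var (if n < c then n else n.+1)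
  | Pre alpha P => Pre alpha (lift_term c P)
  | Sig P => Sig (lift_term c P)
  | Sum P Q => Sum (lift_term c P) (lift_term c Q)
  | Par P Q => Par (lift_term c P) (lift_term c Q)
  | Res P L => Res (lift_term c P) L
  | Rel P f => Rel (lift_term c P) f
  | Mu P => Mu (lift_term c.+1 P)
  end.

(* Capture-avoiding substitution of N for index k; since the binder of k
   disappears, the indices above k are decremented. *)
Fixpoint subst (Lam : countType) (k : nat) (N P : term Lam) : term Lam :=
  match P with
  | Nil => Nil
  | Var n => if n < k then Var n else if n == k then N else Var n.-1
  | Pre alpha P => Pre alpha (subst k N P)
  | Sig P => Sig (subst k N P)
  | Sum P Q => Sum (subst k N P) (subst k N Q)
  | Par P Q => Par (subst k N P) (subst k N Q)
  | Res P L => Res (subst k N P) L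
  | Rel P f => Rel (subst k N P) f
  | Mu P => Mu (subst k.+1 (lift_term 0 N) P)
  end.

(* The set of actions L `|` \bar L. *)
Definition res_set (Lam : countType) (L : {fset label Lam}) :
    {fset act Lam} :=
  [fset vis a | a in L] `|` [fset vis (co a) | a in L].

(* In the parallel case complementation is extended by \bar tau = tau; this
   is harmless because it only matters when tau already belongs to the union
   of the two urgent sets. *)
Fixpoint urgent (Lam : countType) (P : term Lam) : {fset act Lam} :=
  match P with
  | Nil => fset0
  | Var _ => fset0
  | Pre alpha _ => [fset alpha]
  | Sig _ => fset0
  | Sum P Q => urgent P `|` urgent Q
  | Par P Q =>
      urgent P `|` urgent Q `|`
      (if urgent P `&` [fset (omap (@co Lam) beta : act Lam)
                       | beta in urgent Q] != fset0
       then [fset tau] else fset0)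
  | Res P L => urgent P `\` res_set L
  | Rel P f => [fset f alpha | alpha in urgent P]
  | Mu P => urgent P
  end.

Inductive act_step (Lam : countType) :
    term Lam -> act Lam -> term Lam -> Prop :=
| act_pre alpha P : act_step (Pre alpha P) alpha P
| act_sig alpha P P' : act_step P alpha P' -> act_step (Sig P) alpha P'
| act_mu alpha P P' :
    act_step P alpha P' -> act_step (Mu P) alpha (subst 0 (Mu P) P')
| act_suml alpha P P' Q : act_step P alpha P' -> act_step (Sum P Q) alpha P'
| act_sumr alpha P P' Q : act_step P alpha P' -> act_step (Sum Q P) alpha P'
| act_parl alpha P P' Q :
    act_step P alpha P' -> act_step (Par P Q) alpha (Par P' Q)
| act_parr alpha P P' Q :
    act_step P alpha P' -> act_step (Par Q P) alpha (Par Q P')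
| act_com a P P' Q Q' :
    act_step P (vis a) P' -> act_step Q (vis (co a)) Q' ->
    act_step (Par P Q) tau (Par P' Q')
| act_rel alpha P P' (f : relabeling Lam) :
    act_step P alpha P' -> act_step (Rel P f) (f alpha) (Rel P' f)
| act_res alpha P P' L :
    alpha \notin res_set L ->
    act_step P alpha P' -> act_step (Res P L) alpha (Res P' L).

Inductive clock_type := Type1 | Type2.

Inductive clock_step (Lam : countType) (i : clock_type) :
    term Lam -> term Lam -> Prop :=
| clock_nil : clock_step i Nil Nil
| clock_pre a P : clock_step i (Pre (vis a) P) (Pre (vis a) P)
| clock_sig P : clock_step i (Sig P) P
| clock_skip P P' : i = Type2 -> clock_step i P P' -> clock_step i (Sig P) P'
| clock_mu P P' :
    clock_step i P P' -> clock_step i (Mu P) (subst 0 (Mu P) P')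
| clock_res P P' L :
    clock_step i P P' -> clock_step i (Res P L) (Res P' L)
| clock_rel P P' f :
    clock_step i P P' -> clock_step i (Rel P f) (Rel P' f)
| clock_sum P P' Q Q' :
    clock_step i P P' -> clock_step i Q Q' ->
    clock_step i (Sum P Q) (Sum P' Q')
| clock_par P P' Q Q' :
    clock_step i P P' -> clock_step i Q Q' -> tau \notin urgent (Par P Q) ->
    clock_step i (Par P Q) (Par P' Q').

Definition pact (Lam : countType) (P : process Lam) (alpha : act Lam)
    (P' : process Lam) : Prop :=
  act_step (sval P) alpha (sval P').

Definition pclock (Lam : countType) (i : clock_type) (P P' : process Lam) :
    Prop :=
  clock_step i (sval P) (sval P').

Definition pclock_star (Lam : countType) (i : clock_type) :
    process Lam -> process Lam -> Prop :=
  clos_refl_trans (process Lam) (pclock i).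

Definition pclock_plus (Lam : countType) (i : clock_type) :
    process Lam -> process Lam -> Prop :=
  clos_trans (process Lam) (pclock i).

Definition naive_faster_than_rel (Lam : countType) (i : clock_type)
    (R : process Lam -> process Lam -> Prop) : Prop :=
  forall (P Q : process Lam) (alpha : act Lam), R P Q ->
    [/\ forall P', pact P alpha P' -> exists2 Q', pact Q alpha Q' & R P' Q',
        forall Q', pact Q alpha Q' -> exists2 P', pact P alpha P' & R P' Q'
      & forall P', pclock i P P' -> exists2 Q', pclock i Q Q' & R P' Q'].

Definition delayed_faster_than_rel (Lam : countType) (i : clock_type)
    (R : process Lam -> process Lam -> Prop) : Prop :=
  forall (P Q : process Lam) (alpha : act Lam), R P Q ->
    [/\ forall P', pact P alpha P' ->
          exists Q1 Q2 Q', [/\ pclock_star i Q Q1, pact Q1 alpha Q2,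
                               pclock_star i Q2 Q' & R P' Q'],
        forall Q', pact Q alpha Q' -> exists2 P', pact P alpha P' & R P' Q'
      & forall P', pclock i P P' -> exists2 Q', pclock_plus i Q Q' & R P' Q'].

Definition naive_faster_than (Lam : countType) (i : clock_type)
    (P Q : process Lam) : Prop :=
  exists2 R, naive_faster_than_rel i R & R P Q.

Definition delayed_faster_than (Lam : countType) (i : clock_type)
    (P Q : process Lam) : Prop :=
  exists2 R, delayed_faster_than_rel i R & R P Q.

(* Main.v *)
Require Import Defs.
From mathcomp Require Import zify.

(** Let [syn_faster] be the syntactic preorder generated by [P >= sigma.P].
    A clock step always leads to a syntactically faster term, and this preorder
    is itself a naive faster-than relation for both clocks.  Hence delays
    taken by the slower process in a delayed relation [R] can be cancelled by
    passing to the composition of [R] with [syn_faster].  The two clocks are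
    compared likewise: each step of the second clock leads to a term that is
    syntactically faster than the target of some step of the first one. *)

Set Implicit Arguments.
Unset Strict Implicit.
Unset Printing Implicit Defensive.

Local Open Scope fset_scope.

(** A condition that itself contains a conditional is skipped, so nested index computations are
    split from the inside out. *)
Ltac case_indices :=
  rewrite /=;
  repeat match goal with
  | |- context [if ?b then _ else _] =>
      lazymatch b with
      | context [if _ then _ else _] => fail
      | _ => case: (boolP b) => ? /=
      end
  end;
  try solve [done | congr Var; lia | lia].

(* Avoids relying on the hypothesis names generated by [inversion]. *)
Tactic Notation "by_step" uconstr(IH) :=
  match goal with
  | st : _ |- _ => let ex := constr:(IH st) in move: ex
  end.

(** * De Bruijn calculus: commutation of lifting and substitution *)

Lemma lift_lift (Lam : countType) c d (P : term Lam) :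
  c <= d -> lift_term c (lift_term d P) = lift_term d.+1 (lift_term c P).
Proof.
elim: P c d => //=
  [n|a P IH|P IH|P IHP Q IHQ|P IHP Q IHQ|P IH L|P IH f|P IH] c d le_cd;
  rewrite 1?IH 1?IHP 1?IHQ //.
by case_indices.
Qed.

Lemma subst_lift (Lam : countType) c (N P : term Lam) :
  subst c N (lift_term c P) = P.
Proof.
elim: P c N => //=
  [n|a P IH|P IH|P IHP Q IHQ|P IHP Q IHQ|P IH L|P IH f|P IH] c N;
  rewrite 1?IH 1?IHP 1?IHQ //.
by case_indices.
Qed.

Lemma lift_subst (Lam : countType) c k (N P : term Lam) : c <= k ->
  lift_term c (subst k N P) = subst k.+1 (lift_term c N) (lift_term c P).
Proof.
elim: P c k N => //=
  [n|a P IH|P IH|P IHP Q IHQ|P IHP Q IHQ|P IH L|P IH f|P IH] c k N le_ck;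
  rewrite 1?IH 1?IHP 1?IHQ //.
  by case_indices.
by rewrite -lift_lift.
Qed.

(** The substitution lemma. The outer index becomes [k.+1], and [N] is lifted, because index [j] is
    still present in [P]. With [j = 0] and [M] a recursive term, it moves a substitution through the
    unfolding produced by a step of [Mu]. *)
Lemma subst_subst (Lam : countType) j k (M N P : term Lam) : j <= k ->
  subst k N (subst j M P) =
  subst j (subst k N M) (subst k.+1 (lift_term j N) P).
Proof.
elim: P j k M N => //=
  [n|a P IH|P IH|P IHP Q IHQ|P IHP Q IHQ|P IH L|P IH f|P IH] j k M N le_jk;
  rewrite 1?IH 1?IHP 1?IHQ //.
  (* The case left over is [n = k.+1]: the lifted copy of [N] then undergoes the substitution for
     [j], which cancels the lift. *)
  by case_indices; rewrite subst_lift.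
by rewrite lift_subst // -lift_lift.
Qed.

(** * Guardedness, well-formedness and closedness under lifting and substitution *)

Lemma guarded_lift (Lam : countType) c k (P : term Lam) : c <= k ->
  guarded k.+1 (lift_term c P) = guarded k P.
Proof.
elim: P c k => //=
  [n|P IHP Q IHQ|P IHP Q IHQ|P IH] c k le_ck;
  rewrite 1?IH 1?IHP 1?IHQ //.
by case_indices.
Qed.

Lemma guarded_lift_gt (Lam : countType) c k (P : term Lam) : k < c ->
  guarded k (lift_term c P) = guarded k P.
Proof.
elim: P c k => //=
  [n|P IHP Q IHQ|P IHP Q IHQ|P IH] c k lt_kc;
  rewrite 1?IH 1?IHP 1?IHQ //.
by case_indices.
Qed.

(** Lifting at [c] vacates index [c]. With [c = 0] this covers a term substituted under a binder: it
    cannot contain the bound variable, so that variable remains guarded. *)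
Lemma guarded_lift_eq (Lam : countType) c (P : term Lam) :
  guarded c (lift_term c P).
Proof.
elim: P c => //=
  [n|P IHP Q IHQ|P IHP Q IHQ] c; rewrite ?IHP ?IHQ //.
by case_indices.
Qed.

Lemma guarded_subst (Lam : countType) j k (N P : term Lam) : j <= k ->
  guarded k.+1 P -> guarded k N -> guarded k (subst j N P).
Proof.
elim: P j k N => //=
  [n|P IHP Q IHQ|P IHP Q IHQ|P IH] j k N le_jk.
- by case_indices.
- by case/andP=> gP gQ gN; rewrite IHP ?IHQ.
- by case/andP=> gP gQ gN; rewrite IHP ?IHQ.
- by move=> gP gN; apply: IH; rewrite ?guarded_lift.
Qed.

Lemma guarded_subst_gt (Lam : countType) j k (N P : term Lam) : k < j ->
  guarded k P -> guarded k N -> guarded k (subst j N P).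
Proof.
elim: P j k N => //=
  [n|P IHP Q IHQ|P IHP Q IHQ|P IH] j k N lt_kj.
- by case_indices.
- by case/andP=> gP gQ gN; rewrite IHP ?IHQ.
- by case/andP=> gP gQ gN; rewrite IHP ?IHQ.
- by move=> gP gN; apply: IH; rewrite ?guarded_lift.
Qed.

Lemma wf_lift (Lam : countType) c (P : term Lam) : wf (lift_term c P) = wf P.
Proof.
elim: P c => //=
  [P IHP Q IHQ|P IHP Q IHQ|P IH] c; rewrite ?IHP ?IHQ //.
by rewrite IH guarded_lift_gt.
Qed.

Lemma wf_subst (Lam : countType) k (N P : term Lam) :
  wf P -> wf N -> wf (subst k N P).
Proof.
elim: P k N => //=
  [n|P IHP Q IHQ|P IHP Q IHQ|P IH] k N.
- by case_indices.
- by case/andP=> wP wQ wN; rewrite IHP ?IHQ.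
- by case/andP=> wP wQ wN; rewrite IHP ?IHQ.
- case/andP=> gP wP wN; rewrite IH ?wf_lift // andbT.
  exact/guarded_subst_gt/guarded_lift_eq.
Qed.

Lemma closed_lift (Lam : countType) c k (P : term Lam) :
  closed_at k P -> closed_at k.+1 (lift_term c P).
Proof.
elim: P c k => //=
  [n|P IHP Q IHQ|P IHP Q IHQ|P IH] c k.
- by case_indices; lia.
- by case/andP=> cP cQ; rewrite IHP ?IHQ.
- by case/andP=> cP cQ; rewrite IHP ?IHQ.
- exact: IH.
Qed.

Lemma closed_subst (Lam : countType) j k (N P : term Lam) : j <= k ->
  closed_at k.+1 P -> closed_at k N -> closed_at k (subst j N P).
Proof.
elim: P j k N => //=
  [n|P IHP Q IHQ|P IHP Q IHQ|P IH] j k N le_jk.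
- by case_indices; lia.
- by case/andP=> cP cQ cN; rewrite IHP ?IHQ.
- by case/andP=> cP cQ cN; rewrite IHP ?IHQ.
- by move=> cP cN; apply: IH => //; apply: closed_lift.
Qed.

(** * Monotonicity of urgent sets *)

Lemma urgent_par_sub (Lam : countType) (P P' Q Q' : term Lam) :
  urgent P `<=` urgent P' -> urgent Q `<=` urgent Q' ->
  urgent (Par P Q) `<=` urgent (Par P' Q').
Proof.
move=> sP sQ /=; apply: fsetUSS; first exact: fsetUSS.
case: ifP => [|_]; last exact: fsub0set.
(* A complementary pair that makes tau urgent on the left is available on the right as well. *)
case/fset0Pn=> a; rewrite inE => /andP[aP /imfsetP[b /= bQ def_a]].
case: ifP => [_|/negbT/negP[]]; first exact: fsubset_refl.
apply/fset0Pn; exists a; rewrite inE (fsubsetP sP) //=.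
by apply/imfsetP; exists b => //=; apply: (fsubsetP sQ).
Qed.

Lemma urgent_rel_sub (Lam : countType) (P P' : term Lam) (f : relabeling Lam) :
  urgent P `<=` urgent P' -> urgent (Rel P f) `<=` urgent (Rel P' f).
Proof.
move=> sP; apply/fsubsetP=> a /imfsetP[b /= bP ->].
by apply/imfsetP; exists b => //=; apply: (fsubsetP sP).
Qed.

(** Variables have no urgent actions, so replacing them can only add some. Hence, if an instance has
    no urgent tau, neither has the original term. *)
Lemma urgent_subst (Lam : countType) k (N P : term Lam) :
  urgent P `<=` urgent (subst k N P).
Proof.
elim: P k N => //=
  [P IHP Q IHQ|P IHP Q IHQ|P IH L|P IH f] k N.
- exact: fsetUSS.
- exact: urgent_par_sub.
- exact: fsetSD.
- exact: urgent_rel_sub.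
Qed.

(** * Transitions: preservation of well-formedness and closedness, and substitution *)

Lemma wf_act_step (Lam : countType) a (P P' : term Lam) :
  act_step P a P' -> wf P -> wf P'.
Proof.
elim=> {a P P'} //=
  [a P P' _ IH /andP[gP wP]|a P P' Q _ IH /andP[wP wQ]
  |a P P' Q _ IH /andP[wQ wP]|a P P' Q _ IH /andP[wP wQ]
  |a P P' Q _ IH /andP[wQ wP]|a P P' Q Q' _ IHP _ IHQ /andP[wP wQ]].
- by apply: wf_subst; rewrite /= ?gP ?IH.
- exact: IH.
- exact: IH.
- by rewrite IH.
- by rewrite IH ?wQ.
- by rewrite IHP ?IHQ.
Qed.

Lemma closed_act_step (Lam : countType) a (P P' : term Lam) k :
  act_step P a P' -> closed_at k P -> closed_at k P'.
Proof.
move=> st; elim: st k => {a P P'} //=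
  [a P P' _ IH k cP|a P P' Q _ IH k /andP[cP cQ]
  |a P P' Q _ IH k /andP[cQ cP]|a P P' Q _ IH k /andP[cP cQ]
  |a P P' Q _ IH k /andP[cQ cP]|a P P' Q Q' _ IHP _ IHQ k /andP[cP cQ]].
- by apply: closed_subst => //=; apply: IH.
- exact: IH.
- exact: IH.
- by rewrite IH.
- by rewrite IH ?cQ.
- by rewrite IHP ?IHQ.
Qed.

Lemma act_step_subst (Lam : countType) k (N : term Lam) a P P' :
  act_step P a P' -> act_step (subst k N P) a (subst k N P').
Proof.
move=> st; elim: st k N => {a P P'} /=.
- by move=> *; constructor.
- by move=> *; constructor; auto.
- by move=> a P P' _ IH k N; rewrite subst_subst //=; constructor.
- by move=> *; constructor; auto.
- by move=> *; apply: act_sumr; auto.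
- by move=> *; constructor; auto.
- by move=> *; apply: act_parr; auto.
- by move=> b *; apply: (@act_com _ b); auto.
- by move=> *; constructor; auto.
- by move=> *; constructor; auto.
Qed.

(** The initial behaviour of an instance is that of [P] as long as no occurrence of index [k] is
    exposed: a guarded occurrence lies under an action prefix, where [N] cannot contribute to the
    first step. *)
Lemma act_step_subst_inv (Lam : countType) k (N : term Lam) a P R :
  guarded k P -> act_step (subst k N P) a R ->
  exists2 P', act_step P a P' & R = subst k N P'.
Proof.
elim: P k N a R => /=
  [|n|b P IH|P IH|P IHP Q IHQ|P IHP Q IHQ|P IH L|P IH f|P IH] k N a R.
- by move=> _ st; inversion st.
- by case_indices => _ st; inversion st.
- by move=> _ st; inversion st; subst; exists P => //; constructor.
- move=> gP st; inversion st; subst.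
  by_step (IH _ _ _ _ gP); move=> [S stS ->].
  by exists S => //; constructor.
- case/andP=> gP gQ st; inversion st; subst.
    by_step (IHP _ _ _ _ gP); move=> [S stS ->].
    by exists S => //; constructor.
  by_step (IHQ _ _ _ _ gQ); move=> [T stT ->].
  by exists T => //; apply: act_sumr.
- case/andP=> gP gQ st; inversion st; subst.
  + by_step (IHP _ _ _ _ gP); move=> [S stS ->].
    by exists (Par S Q) => //; constructor.
  + by_step (IHQ _ _ _ _ gQ); move=> [T stT ->].
    by exists (Par P T) => //; apply: act_parr.
  + by_step (IHP _ _ _ _ gP); move=> [S stS ->].
    by_step (IHQ _ _ _ _ gQ); move=> [T stT ->].
    by exists (Par S T) => //; apply: act_com stS stT.
- move=> gP st; inversion st; subst.
  by_step (IH _ _ _ _ gP); move=> [S stS ->].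
  by exists (Res S L) => //; constructor.
- move=> gP st; inversion st; subst.
  by_step (IH _ _ _ _ gP); move=> [S stS ->].
  by exists (Rel S f) => //; constructor.
- move=> gP st; inversion st; subst.
  by_step (IH _ _ _ _ gP); move=> [S stS ->].
  (* The derivative [S] of the body comes from the induction hypothesis at [k.+1]; the two orders of
     unfolding and substituting agree by the substitution lemma. *)
  exists (subst 0 (Mu P) S); first by constructor.
  by rewrite [RHS]subst_subst.
Qed.

Lemma clock_step_subst_inv (Lam : countType) i k (N : term Lam) P R :
  guarded k P -> clock_step i (subst k N P) R ->
  exists2 P', clock_step i P P' & R = subst k N P'.
Proof.
elim: P k N R => /=
  [|n|b P IH|P IH|P IHP Q IHQ|P IHP Q IHQ|P IH L|P IH f|P IH] k N R.
- by move=> _ st; inversion st; exists Nil => //; constructor.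
- by case_indices => _ st; inversion st.
- by move=> _ st; inversion st; subst; exists (Pre (vis a) P) => //; constructor.
- move=> gP st; inversion st; subst.
    by exists P => //; constructor.
  by_step (IH _ _ _ gP); move=> [S stS ->].
  by exists S => //; apply: clock_skip.
- case/andP=> gP gQ st; inversion st; subst.
  by_step (IHP _ _ _ gP); move=> [S stS ->].
  by_step (IHQ _ _ _ gQ); move=> [T stT ->].
  by exists (Sum S T) => //; constructor.
- case/andP=> gP gQ st; inversion st; subst.
  by_step (IHP _ _ _ gP); move=> [S stS ->].
  by_step (IHQ _ _ _ gQ); move=> [T stT ->].
  exists (Par S T) => //; constructor=> //.
  (* An urgent tau of [Par P Q] would persist in the instance, contradicting the side condition of
     the given step. *)
  match goal with urg : is_true (_ \notin _) |- _ => apply: contra urg end; apply: (fsubsetP _).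
  exact: (urgent_subst k N (Par P Q)).
- move=> gP st; inversion st; subst.
  by_step (IH _ _ _ gP); move=> [S stS ->].
  by exists (Res S L) => //; constructor.
- move=> gP st; inversion st; subst.
  by_step (IH _ _ _ gP); move=> [S stS ->].
  by exists (Rel S f) => //; constructor.
- move=> gP st; inversion st; subst.
  by_step (IH _ _ _ gP); move=> [S stS ->].
  exists (subst 0 (Mu P) S); first by constructor.
  by rewrite [RHS]subst_subst.
Qed.

(** * The syntactic faster-than preorder and its simulation properties *)

(** Besides the axiom for sigma, the rules follow the shape of clock steps. Action prefixes get no
    congruence rule, since time leaves them unchanged; the rule for [Mu] has an unfolding on its
    left because [clock_mu] produces one. Its guardedness premise makes the steps of that unfolding
    traceable to [P']. *)
Inductive syn_faster (Lam : countType) : term Lam -> term Lam -> Prop :=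
| sf_refl P : syn_faster P P
| sf_trans P Q R : syn_faster P Q -> syn_faster Q R -> syn_faster P R
| sf_sig P : syn_faster P (Sig P)
| sf_sum P P' Q Q' :
    syn_faster P' P -> syn_faster Q' Q -> syn_faster (Sum P' Q') (Sum P Q)
| sf_par P P' Q Q' :
    syn_faster P' P -> syn_faster Q' Q -> syn_faster (Par P' Q') (Par P Q)
| sf_res P P' L : syn_faster P' P -> syn_faster (Res P' L) (Res P L)
| sf_rel P P' f : syn_faster P' P -> syn_faster (Rel P' f) (Rel P f)
| sf_mu P P' :
    guarded 0 P -> syn_faster P' P ->
    syn_faster (subst 0 (Mu P) P') (Mu P).

(** Carries the guardedness premise of [sf_mu] over to [P'], as required for inverting steps of
    [subst 0 (Mu P) P']. *)
Lemma sf_guarded (Lam : countType) (P' P : term Lam) k :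
  syn_faster P' P -> guarded k P -> guarded k P'.
Proof.
move=> sf; elim: sf k => {P' P} //=
  [P Q R _ IHP _ IHQ k gR|P P' Q Q' _ IHP _ IHQ k /andP[gP gQ]
  |P P' Q Q' _ IHP _ IHQ k /andP[gP gQ]|P P' _ _ IH k gP].
- exact/IHP/IHQ.
- by rewrite IHP ?IHQ.
- by rewrite IHP ?IHQ.
- by apply: guarded_subst => //; apply: IH.
Qed.

Lemma sf_wf (Lam : countType) (P' P : term Lam) :
  syn_faster P' P -> wf P -> wf P'.
Proof.
elim=> {P' P} //=
  [P Q R _ IHP _ IHQ wR|P P' Q Q' _ IHP _ IHQ /andP[wP wQ]
  |P P' Q Q' _ IHP _ IHQ /andP[wP wQ]|P P' gP _ IH /andP[_ wP]].
- exact/IHP/IHQ.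
- by rewrite IHP ?IHQ.
- by rewrite IHP ?IHQ.
- by apply: wf_subst; rewrite /= ?gP ?IH.
Qed.

Lemma sf_closed (Lam : countType) (P' P : term Lam) k :
  syn_faster P' P -> closed_at k P -> closed_at k P'.
Proof.
move=> sf; elim: sf k => {P' P} //=
  [P Q R _ IHP _ IHQ k cR|P P' Q Q' _ IHP _ IHQ k /andP[cP cQ]
  |P P' Q Q' _ IHP _ IHQ k /andP[cP cQ]|P P' _ _ IH k cP].
- exact/IHP/IHQ.
- by rewrite IHP ?IHQ.
- by rewrite IHP ?IHQ.
- by apply: closed_subst => //; apply: IH.
Qed.

Lemma sf_subst (Lam : countType) k (N P' P : term Lam) :
  syn_faster P' P -> syn_faster (subst k N P') (subst k N P).
Proof.
move=> sf; elim: sf k N => {P' P} /=.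
- by move=> *; apply: sf_refl.
- by move=> P Q R _ IHP _ IHQ k N; apply: sf_trans (IHP k N) (IHQ k N).
- by move=> *; apply: sf_sig.
- by move=> *; apply: sf_sum; auto.
- by move=> *; apply: sf_par; auto.
- by move=> *; apply: sf_res; auto.
- by move=> *; apply: sf_rel; auto.
- move=> P P' gP _ IH k N; rewrite subst_subst //=; apply: sf_mu => //.
  exact/guarded_subst_gt/guarded_lift_eq.
Qed.

(** Deleting a sigma prefix can only expose further urgent actions. Thus the side condition of
    [clock_par] passes from the faster composition to the slower one. *)
Lemma sf_urgent (Lam : countType) (P' P : term Lam) :
  syn_faster P' P -> urgent P `<=` urgent P'.
Proof.
elim=> {P' P}
  [P|P Q R _ IHP _ IHQ|P|P P' Q Q' _ IHP _ IHQ|P P' Q Q' _ IHP _ IHQ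
  |P P' L _ IH|P P' f _ IH|P P' _ _ IH] //=.
- exact: fsubset_trans IHQ IHP.
- exact: fsetUSS.
- exact: urgent_par_sub.
- exact: fsetSD.
- exact: urgent_rel_sub.
- exact: fsubset_trans IH (urgent_subst _ _ _).
Qed.

Lemma sf_act_step (Lam : countType) (P' P : term Lam) a R' :
  syn_faster P' P -> act_step P' a R' ->
  exists2 R, act_step P a R & syn_faster R' R.
Proof.
move=> sf; elim: sf a R' => {P' P}
  [P|P Q R _ IHP _ IHQ|P|P P' Q Q' sP IHP sQ IHQ|P P' Q Q' sP IHP sQ IHQ
  |P P' L _ IH|P P' f _ IH|P P' gP sP IH] a R'.
- by move=> st; exists R' => //; apply: sf_refl.
- case/IHP=> S /IHQ[T stT sfST] sfS.
  by exists T => //; apply: sf_trans sfS sfST.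
- by move=> st; exists R'; [constructor | apply: sf_refl].
- move=> st; inversion st; subst.
    by_step (IHP _ _); move=> [S stS sfS].
    by exists S => //; constructor.
  by_step (IHQ _ _); move=> [S stS sfS].
  by exists S => //; apply: act_sumr.
- move=> st; inversion st; subst.
  + by_step (IHP _ _); move=> [S stS sfS].
    by exists (Par S Q); [constructor | apply: sf_par].
  + by_step (IHQ _ _); move=> [S stS sfS].
    by exists (Par P S); [apply: act_parr | apply: sf_par].
  + by_step (IHP _ _); move=> [S stS sfS].
    by_step (IHQ _ _); move=> [T stT sfT].
    by exists (Par S T); [apply: act_com stS stT | apply: sf_par].
- move=> st; inversion st; subst.
  by_step (IH _ _); move=> [S stS sfS].
  by exists (Res S L); [constructor | apply: sf_res].
- move=> st; inversion st; subst.
  by_step (IH _ _); move=> [S stS sfS].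
  by exists (Rel S f); [constructor | apply: sf_rel].
(* By guardedness a step of the unfolding is already a step of [P'], to which the induction
   hypothesis applies. *)
- case/(act_step_subst_inv (sf_guarded sP gP)) => S /IH[T stT sfT] ->.
  by exists (subst 0 (Mu P) T); [constructor | apply: sf_subst].
Qed.

Lemma sf_act_step_inv (Lam : countType) (P' P : term Lam) a R :
  syn_faster P' P -> act_step P a R ->
  exists2 R', act_step P' a R' & syn_faster R' R.
Proof.
move=> sf; elim: sf a R => {P' P}
  [P|P Q S _ IHP _ IHQ|P|P P' Q Q' sP IHP sQ IHQ|P P' Q Q' sP IHP sQ IHQ
  |P P' L _ IH|P P' f _ IH|P P' gP sP IH] a R.
- by move=> st; exists R => //; apply: sf_refl.
- case/IHQ=> T /IHP[U stU sfU] sfT.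
  by exists U => //; apply: sf_trans sfU sfT.
- by move=> st; inversion st; subst; exists R => //; apply: sf_refl.
- move=> st; inversion st; subst.
    by_step (IHP _ _); move=> [S stS sfS].
    by exists S => //; constructor.
  by_step (IHQ _ _); move=> [S stS sfS].
  by exists S => //; apply: act_sumr.
- move=> st; inversion st; subst.
  + by_step (IHP _ _); move=> [S stS sfS].
    by exists (Par S Q'); [constructor | apply: sf_par].
  + by_step (IHQ _ _); move=> [S stS sfS].
    by exists (Par P' S); [apply: act_parr | apply: sf_par].
  + by_step (IHP _ _); move=> [S stS sfS].
    by_step (IHQ _ _); move=> [T stT sfT].
    by exists (Par S T); [apply: act_com stS stT | apply: sf_par].
- move=> st; inversion st; subst.
  by_step (IH _ _); move=> [S stS sfS].
  by exists (Res S L); [constructor | apply: sf_res].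
- move=> st; inversion st; subst.
  by_step (IH _ _); move=> [S stS sfS].
  by exists (Rel S f); [constructor | apply: sf_rel].
- move=> st; inversion st; subst.
  by_step (IH _ _); move=> [S stS sfS].
  (* The matching step of [P'] is transported to the unfolding, since action steps are stable under
     substitution. *)
  by exists (subst 0 (Mu P) S); [apply: act_step_subst | apply: sf_subst].
Qed.

Lemma clock_step_sf (Lam : countType) i (P P' : term Lam) :
  clock_step i P P' -> wf P -> syn_faster P' P.
Proof.
elim=> {P P'} /=
  [|a P|P|P P' _ _ IH|P P' _ IH|P P' L _ IH|P P' f _ IH
  |P P' Q Q' _ IHP _ IHQ|P P' Q Q' _ IHP _ IHQ _].
- by move=> _; apply: sf_refl.
- by move=> _; apply: sf_refl.
- by move=> _; apply: sf_sig.
- by move=> /IH sP; apply: sf_trans sP (sf_sig _).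
- by case/andP=> gP /IH sP; apply: sf_mu.
- by move=> /IH sP; apply: sf_res.
- by move=> /IH sP; apply: sf_rel.
- by case/andP=> /IHP sP /IHQ sQ; apply: sf_sum.
- by case/andP=> /IHP sP /IHQ sQ; apply: sf_par.
Qed.

Lemma sf_clock_step (Lam : countType) i (P' P R' : term Lam) :
  syn_faster P' P -> wf P -> clock_step i P' R' ->
  exists2 R, clock_step i P R & syn_faster R' R.
Proof.
move=> sf; elim: sf R' => {P' P}
  [P|P Q R _ IHP sQ IHQ|P|P P' Q Q' sP IHP sQ IHQ|P P' Q Q' sP IHP sQ IHQ
  |P P' L _ IH|P P' f _ IH|P P' gP sP IH] R' /=.
- by move=> _ st; exists R' => //; apply: sf_refl.
- move=> wR /(IHP _ (sf_wf sQ wR))[S /(IHQ _ wR)[T stT sfST] sfS].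
  by exists T => //; apply: sf_trans sfS sfST.
(* [Sig P] answers by shedding its prefix, which both clocks permit; the time step of [P] has led to
   something faster than [P]. *)
- by move=> wP st; exists P; [constructor | apply: clock_step_sf st wP].
- case/andP=> wP wQ st; inversion st; subst.
  by_step (IHP _ wP); move=> [S stS sfS].
  by_step (IHQ _ wQ); move=> [T stT sfT].
  by exists (Sum S T); [constructor | apply: sf_sum].
- case/andP=> wP wQ st; inversion st; subst.
  by_step (IHP _ wP); move=> [S stS sfS].
  by_step (IHQ _ wQ); move=> [T stT sfT].
  exists (Par S T); last exact: sf_par.
  (* If tau were urgent in the slower composition, it would be urgent in the faster one, which has
     just let time pass. *)
  constructor=> //; match goal with urg : is_true (_ \notin _) |- _ => apply: contra urg end; apply: (fsubsetP _).
  exact: sf_urgent (sf_par sP sQ).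
- move=> wP st; inversion st; subst.
  by_step (IH _ wP); move=> [S stS sfS].
  by exists (Res S L); [constructor | apply: sf_res].
- move=> wP st; inversion st; subst.
  by_step (IH _ wP); move=> [S stS sfS].
  by exists (Rel S f); [constructor | apply: sf_rel].
- case/andP=> _ wP.
  case/(clock_step_subst_inv (sf_guarded sP gP)) => S /(IH _ wP)[T stT sfT] ->.
  by exists (subst 0 (Mu P) T); [constructor | apply: sf_subst].
Qed.

(** * Comparison of the two clocks *)

Lemma clock_step_Type2_of_Type1 (Lam : countType) (P P' : term Lam) :
  clock_step Type1 P P' -> clock_step Type2 P P'.
Proof.
by elim=> {P P'} *; try (by constructor); discriminate.
Qed.

Lemma clock_step_Type1_of_Type2 (Lam : countType) (P P' : term Lam) :
  clock_step Type2 P P' -> wf P ->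
  exists2 P'', clock_step Type1 P P'' & syn_faster P' P''.
Proof.
elim=> {P P'} /=
  [|a P|P|P P' _ st _|P P' _ IH|P P' L _ IH|P P' f _ IH
  |P P' Q Q' _ IHP _ IHQ|P P' Q Q' _ IHP _ IHQ urg].
- by exists Nil; [constructor | apply: sf_refl].
- by exists (Pre (vis a) P); [constructor | apply: sf_refl].
- by exists P; [constructor | apply: sf_refl].
(* [clock_skip] is the only rule specific to the second clock. The first clock stops at [P], which
   is slower than the target of any clock step of [P]. *)
- by move=> wP; exists P; [constructor | apply: clock_step_sf st wP].
- case/andP=> _ /IH[S stS sfS].
  by exists (subst 0 (Mu P) S); [constructor | apply: sf_subst].
- by case/IH=> S stS sfS; exists (Res S L); [constructor | apply: sf_res].
- by case/IH=> S stS sfS; exists (Rel S f); [constructor | apply: sf_rel].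
- case/andP=> /IHP[S stS sfS] /IHQ[T stT sfT].
  by exists (Sum S T); [constructor | apply: sf_sum].
- case/andP=> /IHP[S stS sfS] /IHQ[T stT sfT].
  by exists (Par S T); [constructor | apply: sf_par].
Qed.

(** * The syntactic preorder on processes *)

Definition psf (Lam : countType) (P Q : process Lam) : Prop :=
  syn_faster (sval P) (sval Q).

Lemma act_step_process (Lam : countType) (P : process Lam) a P' :
  act_step (sval P) a P' -> is_process P'.
Proof.
case: P => P /= /andP[wP cP] st; apply/andP; split.
  exact: wf_act_step st wP.
exact: closed_act_step st cP.
Qed.

Lemma clock_step_process (Lam : countType) i (P : process Lam) P' :
  clock_step i (sval P) P' -> is_process P'.
Proof.
case: P => P /= /andP[wP cP] /clock_step_sf/(_ wP) sf; apply/andP; split.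
  exact: sf_wf sf wP.
exact: sf_closed sf cP.
Qed.

Lemma process_wf (Lam : countType) (P : process Lam) : wf (sval P).
Proof. by case: P => P /= /andP[]. Qed.

Lemma psf_trans (Lam : countType) (P Q R : process Lam) :
  psf P Q -> psf Q R -> psf P R.
Proof. exact: sf_trans. Qed.

Lemma psf_pact (Lam : countType) (P Q P' : process Lam) a :
  psf P Q -> pact P a P' -> exists2 Q', pact Q a Q' & psf P' Q'.
Proof.
move=> sf /(sf_act_step sf)[R st sfR].
by exists (exist _ R (act_step_process st)).
Qed.

Lemma psf_pact_inv (Lam : countType) (P Q Q' : process Lam) a :
  psf P Q -> pact Q a Q' -> exists2 P', pact P a P' & psf P' Q'.
Proof.
move=> sf /(sf_act_step_inv sf)[R st sfR].
by exists (exist _ R (act_step_process st)).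
Qed.

Lemma psf_pclock (Lam : countType) i (P Q P' : process Lam) :
  psf P Q -> pclock i P P' -> exists2 Q', pclock i Q Q' & psf P' Q'.
Proof.
move=> sf /(sf_clock_step sf (process_wf Q))[R st sfR].
by exists (exist _ R (clock_step_process st)).
Qed.

Lemma pclock_psf (Lam : countType) i (P P' : process Lam) :
  pclock i P P' -> psf P' P.
Proof. by move/clock_step_sf; apply; apply: process_wf. Qed.

Lemma pclock_star_psf (Lam : countType) i (P P' : process Lam) :
  pclock_star i P P' -> psf P' P.
Proof.
elim=> {P P'} [P P'|P|P Q R _ sPQ _ sQR].
- exact: pclock_psf.
- exact: sf_refl.
- exact: psf_trans sQR sPQ.
Qed.

Lemma pclock_plus_first (Lam : countType) i (P P' : process Lam) :
  pclock_plus i P P' -> exists2 Q, pclock i P Q & psf P' Q.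
Proof.
elim=> {P P'} [P P' st|P Q R _ [S stS sfS] _ [T stT sfT]].
  by exists P' => //; apply: sf_refl.
(* The chain is [R], [T], [Q], [S], from fastest to slowest: [T] is a clock successor of [Q], hence
   faster than [Q]. *)
by exists S => //; apply: psf_trans (psf_trans sfT (pclock_psf stT)) sfS.
Qed.

Lemma pclock_Type1_of_Type2 (Lam : countType) (P P' : process Lam) :
  pclock Type2 P P' -> exists2 P'', pclock Type1 P P'' & psf P' P''.
Proof.
case/clock_step_Type1_of_Type2/(_ (process_wf P)) => R st sfR.
by exists (exist _ R (clock_step_process st)).
Qed.

(** * Coincidence of the four faster-than relations *)

Lemma naive_delayed (Lam : countType) i (P Q : process Lam) :
  naive_faster_than i P Q -> delayed_faster_than i P Q.
Proof.
case=> R nvR PQ; exists R => // {P Q PQ} P Q a /(nvR P Q a)[act1 act2 clk].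
split=> // P'.
- by case/act1=> Q' st RQ'; exists Q, Q', Q'; split=> //; apply: rt_refl.
- by case/clk=> Q' st RQ'; exists Q' => //; apply: t_step.
Qed.

Lemma delayed_naive (Lam : countType) i (P Q : process Lam) :
  delayed_faster_than i P Q -> naive_faster_than i P Q.
Proof.
case=> R dlR PQ; exists (fun P S => exists2 Q, R P Q & psf Q S); last first.
  by exists Q => //; apply: sf_refl.
move=> {P Q PQ} P S a [Q /(dlR P Q a)[act1 act2 clk] QS]; split.
(* The delays before the action make [Q1] faster than [Q], hence than [S], so [S] can act
   immediately; those after it make [Q'] faster than [Q2], hence than [S']. *)
- move=> P' /act1[Q1 [Q2 [Q' [/pclock_star_psf s1 st /pclock_star_psf s2 RQ']]]].
  have [S' stS s3] := psf_pact (psf_trans s1 QS) st.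
  by exists S' => //; exists Q' => //; apply: psf_trans s2 s3.
- move=> S' /(psf_pact_inv QS)[Q' /act2[P' st RP'] QS'].
  by exists P' => //; exists Q'.
- move=> P' /clk[Q' /pclock_plus_first[Q1 st s1] RQ'].
  have [S' stS s2] := psf_pclock QS st.
  by exists S' => //; exists Q' => //; apply: psf_trans s1 s2.
Qed.

(** The syntactic preorder is composed on the left of [R]: a challenge of the second clock has to be
    turned into a step of the first clock, with a slower target, before [R] can be applied. The
    answer then counts for the second clock as it is. *)
Lemma naive_Type2_of_Type1 (Lam : countType) (P Q : process Lam) :
  naive_faster_than Type1 P Q -> naive_faster_than Type2 P Q.
Proof.
case=> R nvR PQ; exists (fun S Q => exists2 P, psf S P & R P Q); last first.
  by exists P => //; apply: sf_refl.
move=> {P Q PQ} S Q a [P SP /(nvR P Q a)[act1 act2 clk]]; split.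
- move=> S' /(psf_pact SP)[P' /act1[Q' st RQ'] SP'].
  by exists Q' => //; exists P'.
- move=> Q' /act2[P' /(psf_pact_inv SP)[S' st SP'] RP'].
  by exists S' => //; exists P'.
- move=> S' /(psf_pclock SP)[P1 /pclock_Type1_of_Type2[P' st s2] s1].
  have [Q' stQ RQ'] := clk _ st.
  exists Q'; first exact: clock_step_Type2_of_Type1.
  by exists P' => //; apply: psf_trans s1 s2.
Qed.

(** Here the composition is on the right: the challenge is already a step of the second clock, and
    it is the answer given by [R] that must be turned into a step of the first clock with a slower
    target. *)
Lemma naive_Type1_of_Type2 (Lam : countType) (P Q : process Lam) :
  naive_faster_than Type2 P Q -> naive_faster_than Type1 P Q.
Proof.
case=> R nvR PQ; exists (fun P S => exists2 Q, R P Q & psf Q S); last first.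
  by exists Q => //; apply: sf_refl.
move=> {P Q PQ} P S a [Q /(nvR P Q a)[act1 act2 clk] QS]; split.
- move=> P' /act1[Q' /(psf_pact QS)[S' st QS'] RQ'].
  by exists S' => //; exists Q'.
- move=> S' /(psf_pact_inv QS)[Q' /act2[P' st RP'] QS'].
  by exists P' => //; exists Q'.
- move=> P' /clock_step_Type2_of_Type1/clk[Q' /(psf_pclock QS)[S1 st s1] RQ'].
  have [S' stS s2] := pclock_Type1_of_Type2 st.
  by exists S' => //; exists Q' => //; apply: psf_trans s1 s2.
Qed.

Theorem theorem13 (Lam : countType) (P Q : process Lam) :
  (naive_faster_than Type1 P Q <-> naive_faster_than Type2 P Q) /\
  (naive_faster_than Type2 P Q <-> delayed_faster_than Type1 P Q) /\
  (delayed_faster_than Type1 P Q <-> delayed_faster_than Type2 P Q).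
Proof.
split; [|split]; split.
- exact: naive_Type2_of_Type1.
- exact: naive_Type1_of_Type2.
- by move/naive_Type1_of_Type2/naive_delayed.
- by move/delayed_naive/naive_Type2_of_Type1.
- by move/delayed_naive/naive_Type2_of_Type1/naive_delayed.
- by move/delayed_naive/naive_Type1_of_Type2/naive_delayed.
Qed.
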